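(* For each missingness pattern $m\in\mathcal M\subseteq\{0,1\}^p$, given $f(x_{\bar m},m)>0$, let the function $\eta_m:\mathcal X_{\bar m}\to\mathbb R$ be defined recursively as $$\eta_m(x_{\bar m})=\log f(x_{\bar m},m)-\log\int_{\mathcal X_m}\exp\Big\{\sum_{m'\prec m}\eta_{m'}(x_{\bar m'})\,I(m'\in\mathcal M)\Big\}\,\mu(dx_m).$$ Then $$g(x,m)=\exp\Big\{\sum_{m'\preceq m}\eta_{m'}(x_{\bar m'})\,I(m'\in\mathcal M)\Big\}$$ satisfies $$\int_{\mathcal X_m} g(x,m)\,\mu(dx_m)=f(x_{\bar m},m)$$ for all $(x,m)\in\mathcal X\times\mathcal M$.
   Context: Setup. $X=(X_1,\dots,X_p)$ is a vector of $p$ random variables (items) taking values in a sample space $\mathcal X$, and $M=(M_1,\dots,M_p)$ is the vector of missingness indicators, taking values in $\mathcal M\subseteq\{0,1\}^p$, where $M_j=1$ if item $j$ is missing and $M_j=0$ if it is observed. It is assumed that $0_p\in\mathcal M$, where $0_p$ is the vector of $p$ zeros (there is positive probability of observing all items simultaneously). $\mu$ is a dominating measure for the distribution of $X$, $\nu$ is the product of $\mu$ and the counting measure on $\mathcal M$, and $f(x,m)$ is the density, with respect to $\nu$, of the joint (full-data) distribution of $X$ and $M$. Notation. An element $m=(m_1,\dots,m_p)\in\{0,1\}^p$ is called a missingness pattern, and $\bar m=1_p-m$, where $1_p$ is the vector of $p$ ones. For a pattern $m$, $X_m=(X_j:m_j=1)$ are the missing variables and $X_{\bar m}=(X_j:\bar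 m_j=1)$ the observed variables, with sample spaces $\mathcal X_m$ and $\mathcal X_{\bar m}$; for $x\in\mathcal X$, $x_m$ and $x_{\bar m}$ are defined in the same way. The notation $\mu(dx_m)$ denotes integration over the missing coordinates $x_m$ with $x_{\bar m}$ held fixed; for $m=0_p$ there is nothing to integrate and the sum over $m'\prec 0_p$ is empty, so $\eta_{0_p}(x)=\log f(x,0_p)$. The observed-data density is $$f(x_{\bar m},m)=\int_{\mathcal X_m} f(x,m)\,\mu(dx_m),$$ and it is assumed that the set of $(x_{\bar m},m)$ with $f(x_{\bar m},m)=0$ has probability zero. Partial order: for $m,m'\in\{0,1\}^p$, $m\preceq m'$ if $m'_j=1$ for all $j$ such that $m_j=1$; $m\prec m'$ means $m\preceq m'$ and $m\neq m'$. $I(\cdot)$ is the indicator function, and terms with $m'\notin\mathcal M$ contribute $0$ to the sums.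
   Formalization: It is assumed that each η_m is finite wherever f(x_m̄,m)>0 (the integral in its definition can vanish or diverge, and then the claim fails); where f(x_m̄,m)=0, η_m is taken as −∞ with exp(−∞)=0; μ is a product of σ-finite measures on the item spaces. *)

(* Defs.v *)
From HB Require Import structures.
From mathcomp Require Import all_boot all_order all_algebra.
From mathcomp Require Import all_classical all_reals all_analysis.
From mathcomp Require Import measurable_realfun.

Set Implicit Arguments.
Unset Strict Implicit.
Unset Printing Implicit Defensive.

Import Order.TTheory GRing.Theory Num.Theory.
Import numFieldNormedType.Exports.

Local Open Scope classical_set_scope.
Local Open Scope ring_scope.
Local Open Scope ereal_scope.

Section product_space.
Context (I : finType) (d : I -> measure_display)
  (T : forall i, measurableType (d i)).

Definition coord_preimages : set (set (forall i, T i)) :=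
  [set A | exists i, exists2 B : set (T i),
             measurable B & A = [set x | B (x i)]].

Definition prod_space := forall i, T i.
HB.instance Definition _ := Pointed.on prod_space.
HB.instance Definition _ := Measurable.copy prod_space
  (g_sigma_algebraType coord_preimages).

Lemma measurable_coord i : measurable_fun [set: prod_space] (fun x => x i).
Proof.
move=> _ B mB; rewrite setTI; apply: sub_sigma_algebra.
by exists i; exists B.
Qed.

Lemma measurable_to_prod_space d' (S : measurableType d')
    (h : S -> prod_space) :
  (forall i, measurable_fun [set: S] (fun s => h s i)) ->
  measurable_fun [set: S] h.
Proof.
move=> mh.
apply: (@measurability _ _ S prod_space setT h coord_preimages) => //.
move=> _ [_ [i [B mB ->]] <-].
exact: (mh i measurableT B mB).
Qed.

Lemma measurable_dfwith i :
  measurable_fun [set: prod_space * T i]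
    (fun u => dfwith u.1 i u.2 : prod_space).
Proof.
apply: measurable_to_prod_space => j.
have [<-{j}|ij ] := eqVneq i j.
  rewrite (_ : (fun _ => _) = snd); first exact: measurable_snd.
  by apply/funext => u; rewrite dfwithin.
rewrite (_ : (fun _ => _) = (fun x : prod_space => x j) \o fst).
  by apply: measurableT_comp; [exact: measurable_coord|exact: measurable_fst].
by apply/funext => u; rewrite /= dfwithout.
Qed.

Context (R : realType) (mu : forall i, {sigma_finite_measure set (T i) -> \bar R}).

Implicit Types (s : seq I) (h : prod_space -> \bar R) (x : prod_space).

Fixpoint iterated_integral (s : seq I) (h : prod_space -> \bar R)
    (x : prod_space) : \bar R :=
  if s is i :: s' then \int[mu i]_t iterated_integral s' h (dfwith x i t)
  else h x.

(* The base point is irrelevant: every coordinate is integrated out. *)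
Definition prod_measure (A : set prod_space) : \bar R :=
  iterated_integral (enum I) (fun x => (\1_A x)%:E) point.

Lemma iterated_integral_ge0 s h x :
  (forall y, 0 <= h y) -> 0 <= iterated_integral s h x.
Proof.
move=> h0; elim: s x => [|i s IHs] x //=.
by apply: integral_ge0 => t _; exact: IHs.
Qed.

Lemma measurable_iterated_integral s h :
  (forall y, 0 <= h y) -> measurable_fun [set: prod_space] h ->
  measurable_fun [set: prod_space] (iterated_integral s h).
Proof.
move=> h0 mh; elim: s => [|i s IHs] //=.
have := @measurable_fun_fubini_tonelli_F _ _ prod_space (T i) R (mu i)
  (fun u => iterated_integral s h (dfwith u.1 i u.2)).
apply; first exact: (measurableT_comp IHs (@measurable_dfwith i)).
by move=> u; exact: iterated_integral_ge0.
Qed.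

Lemma measurable_iterated_integral_slice s h x i :
  (forall y, 0 <= h y) -> measurable_fun [set: prod_space] h ->
  measurable_fun [set: T i] (fun t => iterated_integral s h (dfwith x i t)).
Proof.
move=> h0 mh.
have mx : measurable_fun [set: T i] (fun t : T i => (x, t)).
  exact: measurable_fun_pair.
exact: (measurableT_comp (measurableT_comp
  (measurable_iterated_integral s h0 mh) (@measurable_dfwith i)) mx).
Qed.

Lemma iterated_integral_nneseries s (h : (prod_space -> \bar R)^nat) x :
  (forall n y, 0 <= h n y) ->
  (forall n, measurable_fun [set: prod_space] (h n)) ->
  iterated_integral s (fun y => \sum_(n <oo) h n y) x =
  \sum_(n <oo) iterated_integral s (h n) x.
Proof.
move=> h0 mh; elim: s x => [|i s IHs] x //=.
rewrite -integral_nneseries //.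
- by apply: eq_integral => t _; exact: IHs.
- by move=> n; exact: measurable_iterated_integral_slice.
- by move=> n t _; exact: iterated_integral_ge0.
Qed.

Let prod_measure0 : prod_measure set0 = 0.
Proof.
rewrite /prod_measure; elim: (enum I) point => [|i s IHs] x /=.
  by rewrite indic0.
by apply: integral0_eq => t _; exact: IHs.
Qed.

Let prod_measure_ge0 A : 0 <= prod_measure A.
Proof. by apply: iterated_integral_ge0 => y; rewrite lee_fin. Qed.

Let prod_measure_sigma_additive : semi_sigma_additive prod_measure.
Proof.
move=> F mF tF mUF.
rewrite [X in _ --> X](_ : _ = \sum_(n <oo) prod_measure (F n)).
  by apply/cvg_closeP; split; [exact: is_cvg_nneseries|rewrite closeE].
rewrite /prod_measure -iterated_integral_nneseries.
- congr (iterated_integral _ _ _); apply/funext => y.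
  rewrite -[LHS]/(\d_y (\bigcup_n F n)) measure_semi_bigcup //.
- by move=> n y; rewrite lee_fin.
- by move=> n; apply/measurable_EFinP.
Qed.

HB.instance Definition _ := isMeasure.Build _ prod_space R prod_measure
  prod_measure0 prod_measure_ge0 prod_measure_sigma_additive.

Lemma iterated_integral_rect s (A : forall i, set (T i)) x :
  uniq s -> (forall i, measurable (A i)) ->
  iterated_integral s (fun y => (\1_[set z | forall i, A i (z i)] y)%:E) x =
  (\1_[set z : prod_space | forall i, i \notin s -> A i (z i)] x)%:E *
  \prod_(i <- s) mu i (A i).
Proof.
move=> + mA; elim: s x => [|i s IHs] x /=.
  move=> _; rewrite big_nil mule1; congr (\1_ _ x)%:E.
  by apply/seteqP; split=> z Az j; [move=> _|]; exact: Az.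
move=> /andP[si us]; rewrite big_cons.
under eq_integral do rewrite IHs //.
set S := (X in \1_X x); set c := \prod_(j <- s) _.
have c0 : 0 <= c by apply: prode_ge0.
have E t : (\1_[set z : prod_space | forall i0, i0 \notin s -> A i0 (z i0)]
    (dfwith x i t))%:E = (\1_S x)%:E * (\1_(A i) t)%:E :> \bar R.
  rewrite -EFinM !indicE -natrM mulnb; congr ((_ : bool)%:R)%:E.
  apply/idP/andP; rewrite !inE.
    move=> H; split; last by have := H i si; rewrite dfwithin.
    move=> j; rewrite inE negb_or => /andP[ji js].
    by have := H j js; rewrite dfwithout // eq_sym.
  move=> [xS At] j js; have [ij|ij] := eqVneq i j.
    by subst j; rewrite dfwithin.
  by rewrite dfwithout //; apply: xS; rewrite inE negb_or eq_sym ij.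
rewrite (_ : (fun t => _) = (fun t => (\1_S x)%:E * c * (\1_(A i) t)%:E)).
  rewrite ge0_integralZl //; last by rewrite mule_ge0 // lee_fin.
    by rewrite integral_indic // setIT -muleA [c * _]muleC.
  by apply/measurable_EFinP.
by apply/funext => t; rewrite E muleAC.
Qed.

Lemma prod_measure_rect (A : forall i, set (T i)) :
  (forall i, measurable (A i)) ->
  prod_measure [set x | forall i, A i (x i)] = \prod_i mu i (A i).
Proof.
move=> mA; rewrite /prod_measure iterated_integral_rect ?enum_uniq //.
rewrite big_enum indicE mem_set ?mul1e //.
by move=> i /=; rewrite mem_enum.
Qed.

End product_space.

(* A pattern m marks item j as missing when m j is true. *)
Notation pattern p := {ffun 'I_p -> bool}.

Section missingness.
Context (p : nat) (d : 'I_p -> measure_display)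
  (T : forall j, measurableType (d j)).
Implicit Types m : pattern p.

Definition pattern0 : pattern p := [ffun=> false].

Definition patternC m : pattern p := [ffun j => ~~ m j].

Definition pattern_le m m' : bool := [forall j, m j ==> m' j].

Definition pattern_lt m m' : bool := pattern_le m m' && (m != m').

Definition full_space := prod_space T.

Definition sub_space m :=
  prod_space (fun j : {j : 'I_p | m j} => T (val j)).

Definition sub_vector m (x : full_space) : sub_space m := fun j => x (val j).
Arguments sub_vector m x : clear implicits.

Lemma patternC_true m j : ~ m j -> patternC m j.
Proof. by move=> /negP mj; rewrite ffunE. Qed.

Definition assemble m (y : sub_space m) (z : sub_space (patternC m)) :
    full_space :=
  fun j => match @idP (m j) with
           | ReflectT mj => y (exist _ j mj)
           | ReflectF mj => z (exist _ j (patternC_true mj))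
           end.

Context (R : realType) (mu : forall j, {sigma_finite_measure set (T j) -> \bar R}).

Definition full_measure : {measure set full_space -> \bar R} :=
  prod_measure mu.

Definition sub_measure m : {measure set (sub_space m) -> \bar R} :=
  prod_measure (fun j : {j : 'I_p | m j} => mu (val j)).

(* f is the density of the law of (X, Mis) with respect to the product of
   full_measure and the counting measure on the set MM of patterns. *)
Record joint_density d' (Omega : measurableType d') (P : probability Omega R)
    (X : Omega -> full_space) (Mis : Omega -> pattern p)
    (MM : {set pattern p}) (f : full_space -> pattern p -> R) : Prop := {
  jd_measurable_X : measurable_fun [set: Omega] X ;
  jd_measurable_Mis : forall m, measurable [set w | Mis w = m] ;
  jd_range_Mis : forall w, Mis w \in MM ;
  jd_ge0 : forall x m, m \in MM -> (0 <= f x m)%R ;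
  jd_measurable : forall m, m \in MM ->
    measurable_fun [set: full_space] (fun x => f x m) ;
  jd_law : forall m (A : set full_space), m \in MM -> measurable A ->
    P [set w | A (X w) /\ Mis w = m] = \int[full_measure]_(x in A) (f x m)%:E
}.

Definition obs_density (f : full_space -> pattern p -> R) m
    (z : sub_space (patternC m)) : \bar R :=
  \int[sub_measure m]_y (f (assemble y z) m)%:E.

(* The sums of eta are taken in the extended reals, where -oo stands for the
   logarithm of 0 and expeR -oo = 0. *)
Definition g_density (MM : {set pattern p})
    (eta : forall m, sub_space (patternC m) -> \bar R)
    (x : full_space) m : \bar R :=
  expeR (\sum_(m' in MM | pattern_le m' m) eta m' (sub_vector (patternC m') x)).

Definition eta_normalizer (MM : {set pattern p})
    (eta : forall m, sub_space (patternC m) -> \bar R)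
    m (z : sub_space (patternC m)) : \bar R :=
  \int[sub_measure m]_y expeR (\sum_(m' in MM | pattern_lt m' m)
     eta m' (sub_vector (patternC m') (assemble y z))).

End missingness.

Arguments sub_vector {p d T} m x.
Arguments obs_density {p d T R} mu f m z.
Arguments g_density {p d T R} MM eta x m.
Arguments eta_normalizer {p d T R} mu MM eta m z.

(* Main.v *)
(* In the sum defining g_m only the terms with m' < m involve the missing
   coordinates, so exp(eta_m) factors out of the integral over them, and what
   remains is the normalizer of eta_m.  The factor comes out although eta is not
   known to be measurable, because scaling by a positive real is a bijection
   between the simple functions below h and those below k h.  Where the
   observed-data density vanishes, eta_m = -oo absorbs the other terms and g_m
   is 0. *)
Require Import Defs.
From HB Require Import structures.
From mathcomp Require Import all_boot all_order all_algebra.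
From mathcomp Require Import all_classical all_reals all_analysis.
From mathcomp Require Import measurable_realfun.

Set Implicit Arguments.
Unset Strict Implicit.
Unset Printing Implicit Defensive.

Import Order.TTheory GRing.Theory Num.Theory.
Import numFieldNormedType.Exports.

Local Open Scope classical_set_scope.
Local Open Scope ring_scope.
Local Open Scope ereal_scope.

Section integral_scaling.
Context d (T : measurableType d) (R : realType).
Variable mu : {measure set T -> \bar R}.

(** Both integrals are suprema over simple functions: each [h] below [f] yields the competitor
    [k * h] below [k * f]. *)
Lemma le_nonneg_integralZl (k : R) (f : T -> \bar R) :
  (0 < k)%R -> (forall x, 0 <= f x) ->
  k%:E * \int[mu]_x f x <= \int[mu]_x (k%:E * f x).
Proof.
move=> k0 f0; rewrite muleC -lee_pdivlMr //.
rewrite [leLHS]ge0_integralTE //; apply: ge_ereal_sup => _ [h /= hf <-].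
rewrite lee_pdivlMr // muleC ge0_integralTE; last first.
  by move=> x; rewrite mule_ge0 // lee_fin ltW.
apply: ereal_sup_ubound; exists (scale_nnsfun h (ltW k0)) => /=.
  by move=> x; rewrite EFinM lee_pmul2l.
by rewrite -sintegralrM.
Qed.

(** The missing inequality is the previous one applied to [k^-1] and [k * f]. *)
Lemma nonneg_integralZl (k : R) (f : T -> \bar R) :
  (0 < k)%R -> (forall x, 0 <= f x) ->
  \int[mu]_x (k%:E * f x) = k%:E * \int[mu]_x f x.
Proof.
move=> k0 f0; apply/eqP; rewrite eq_le le_nonneg_integralZl // andbT.
have kf0 x : 0 <= k%:E * f x by rewrite mule_ge0 // lee_fin ltW.
have kV0 : (0 < k^-1)%R by rewrite invr_gt0.
have := le_nonneg_integralZl kV0 kf0.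
under [X in _ <= X -> _]eq_integral
  do rewrite muleA -EFinM mulVf ?gt_eqF // mul1e.
by rewrite muleC lee_pdivrMr // muleC.
Qed.

End integral_scaling.

Section patterns.
Context (p : nat) (d : 'I_p -> measure_display)
  (T : forall j, measurableType (d j)).

(** This is what makes the [eta m] factor constant in the integration variable [y]. *)
Lemma sub_vectorC_assemble (m : pattern p) (y : sub_space T m)
    (z : sub_space T (patternC m)) :
  sub_vector (patternC m) (assemble y z) = z.
Proof.
apply: functional_extensionality_dep => -[j mj].
rewrite /sub_vector /assemble /=; case: {-}_ / idP => [mj'|mj'].
  by exfalso; move: (mj); rewrite ffunE mj'.
by congr (z (exist _ j _)); exact: bool_irrelevance.
Qed.

Lemma g_densityE (R : realType) (MM : {set pattern p})
    (eta : forall m : pattern p, sub_space T (patternC m) -> \bar R) x m :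
  m \in MM ->
  g_density MM eta x m =
  expeR (eta m (sub_vector (patternC m) x)) *
  expeR (\sum_(m' in MM | pattern_lt m' m)
           eta m' (sub_vector (patternC m') x)).
Proof.
(* [expeRD] needs no finiteness: the conventions -oo + +oo = -oo and 0 * +oo = 0 agree under
   [expeR]. *)
move=> mMM; rewrite -expeRD /g_density (bigD1 m) /=; last first.
  by rewrite mMM; apply/forallP => j; rewrite implybb.
congr (expeR (_ + _)); apply: eq_bigl => m'.
by rewrite /pattern_lt andbA.
Qed.

End patterns.

Theorem theorem1 (R : realType) (p : nat) (d : 'I_p -> measure_display)
  (T : forall j, measurableType (d j))
  (mu : forall j, {sigma_finite_measure set (T j) -> \bar R})
  (d' : measure_display) (Omega : measurableType d') (P : probability Omega R)
  (X : Omega -> full_space T) (Mis : Omega -> pattern p)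
  (MM : {set pattern p}) (f : full_space T -> pattern p -> R)
  (f_density : joint_density mu P X Mis MM f)
  (MM0 : pattern0 p \in MM)
  (P0_gt0 : 0 < P [set w | Mis w = pattern0 p])
  (obs_neq0 : {ae P, forall w,
     obs_density mu f (Mis w) (sub_vector (patternC (Mis w)) (X w)) <> 0})
  (eta : forall m : pattern p, sub_space T (patternC m) -> \bar R)
  (* the recursion, where the observed-data density is positive *)
  (eta_rec : forall m z, m \in MM -> 0 < obs_density mu f m z ->
     eta m z = lne (obs_density mu f m z) - lne (eta_normalizer mu MM eta m z))
  (* eta is real-valued there *)
  (eta_real : forall m z, m \in MM -> 0 < obs_density mu f m z ->
     eta m z \is a fin_num)
  (* elsewhere, log 0 *)
  (eta_log0 : forall m z, m \in MM -> obs_density mu f m z = 0 ->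
     eta m z = -oo) :
  forall (x : full_space T) (m : pattern p), m \in MM ->
    \int[sub_measure mu m]_y
       g_density MM eta (assemble y (sub_vector (patternC m) x)) m =
    obs_density mu f m (sub_vector (patternC m) x).
Proof.
move=> x m mMM; set z := sub_vector _ x.
have D0 : 0 <= obs_density mu f m z.
  by apply: integral_ge0 => y _; rewrite lee_fin (jd_ge0 f_density).
under eq_integral do rewrite g_densityE // sub_vectorC_assemble.
move: D0; rewrite le_eqVlt => /predU1P[D0|D_gt0].
  (* The factor [expeR -oo] = 0 kills the integrand even where the other factor is +oo. *)
  rewrite eta_log0 // -D0; apply: integral0_eq => y _.
  by rewrite /= mul0e.
have := eta_real _ _ mMM D_gt0; have := eta_rec _ _ mMM D_gt0.
set N := eta_normalizer mu MM eta m z.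
have N0 : 0 <= N by apply: integral_ge0 => y _; exact: expeR_ge0.
have expeR_lne (u : \bar R) : 0 <= u -> expeR (lne u) = u.
  by move=> u0; apply/eqP; rewrite lneK_eq.
move=> etaE eta_fin.
have [r etar] : exists r, eta m z = r%:E by exists (fine (eta m z)); rewrite fineK.
rewrite etar /= nonneg_integralZl ?expR_gt0 //; last by move=> y; exact: expeR_ge0.
rewrite -/(eta_normalizer mu MM eta m z) -/N -[(expR r)%:E]/(expeR r%:E).
(* Writing [N] as [expeR (lne N)] lets the two logarithms cancel. This requires [lne N] finite,
   which follows from [eta m z] being finite; so [N] is neither 0 nor +oo. *)
rewrite -[X in _ * X](expeR_lne _ N0) -expeRD -etar etaE subeK ?expeR_lne ?ltW //.
by move: eta_fin; rewrite etaE fin_numB => /andP[].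
Qed.
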